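(* There exist infinitely many pairwise non-isomorphic connected graphs $G$ with $v(G)>1$, all of whose vertices have degree $1$, $3$ or $4$, such that $$u(G)=\frac{1}{3}\,t(G)+\frac{1}{4}\,s(G)+\frac{3}{2}.$$
   Context: Graphs are finite, undirected, without loops and multiple edges; $v(G)$ is the number of vertices of $G$. For a connected graph $G$, $u(G)$ denotes the maximal number of leaves in a spanning tree of $G$. $s(G)$ denotes the number of vertices of $G$ of degree $1$ or $3$, and $t(G)$ the number of vertices of $G$ of degree at least $4$. *)

(* Defs.v *)
From mathcomp Require Import all_boot.

Set Implicit Arguments.
Unset Strict Implicit.
Unset Printing Implicit Defensive.

Record sgraph := SGraph {
  vert :> finType;
  adj : rel vert;
  adj_sym : symmetric adj;
  adj_irr : irreflexive adj
}.

Definition isomorphic (G H : sgraph) : Prop :=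
  exists2 f : G -> H, bijective f & forall x y, adj (f x) (f y) = adj x y.

Section Relations.
Variables (T : finType) (e : rel T).

Definition degree (x : T) : nat := #|[set y | e x y]|.

Definition connected : bool := [forall x, forall y, connect e x y].

(* The length is bounded only to quantify over a finite type: a cycle without
   repeated vertices has at most #|T| of them, see acyclicP. *)
Definition acyclic : bool :=
  [forall n : 'I_#|T|.+1, forall c : n.-tuple T, (2 < n) ==> ~~ ucycleb e c].

Lemma acyclicP :
  reflect (forall c : seq T, 2 < size c -> ~ ucycle e c) acyclic.
Proof.
apply: (iffP forallP) => [ac c c_gt2 c_cyc | ac n].
  have c_le : size c < #|T|.+1.
    by case/andP: c_cyc => _ /card_uniqP <-; rewrite ltnS max_card.
  by have /forallP/(_ (in_tuple c)) := ac (Ordinal c_le); rewrite c_gt2 /=; apply/negP/negPn.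
apply/forallP => c; apply/implyP => n_gt2; apply/negP.
by apply: ac; rewrite size_tuple.
Qed.

End Relations.

Definition edges (G : sgraph) : {set {set G}} :=
  [set [set p.1; p.2] | p : G * G & adj p.1 p.2].

(* A spanning subgraph of G is given by its set F of edges. *)
Definition edge_rel (T : finType) (F : {set {set T}}) : rel T :=
  [rel x y | [set x; y] \in F].

Definition spanning_tree (G : sgraph) (F : {set {set G}}) : bool :=
  [&& F \subset edges G, connected (edge_rel F) & acyclic (edge_rel F)].

Definition leaves (T : finType) (F : {set {set T}}) : nat :=
  #|[set x | degree (edge_rel F) x == 1]|.

Definition max_leaves (G : sgraph) : nat :=
  \max_(F : {set {set G}} | spanning_tree F) leaves F.

Definition nb_vertices (G : sgraph) : nat := #|G|.

Definition nb_deg13 (G : sgraph) : nat :=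
  #|[set x : G | degree (@adj G) x \in [:: 1; 3]]|.

Definition nb_deg_ge4 (G : sgraph) : nat := #|[set x : G | 4 <= degree (@adj G) x]|.

(* Main.v *)
Require Import Defs.
From mathcomp Require Import all_boot all_order all_algebra.
From mathcomp Require Import zify lra.

Import GRing.Theory Num.Theory.

(** The extremal graphs are chains of diamonds.  A diamond is K4 minus an edge,
    with vertices a, b, c, d and a, d nonadjacent; [chain k] strings k diamonds
    together by bridges joining the d of each one to the a of the next, and hangs
    a pendant vertex at each end.  It has two vertices of degree 1, all 4k others
    have degree 3, and (4k + 2) / 4 + 3 / 2 = k + 2, so the task is to show that
    the maximal number of leaves is k + 2.

    At most k + 2 ([leaves_le]): cut the vertices into k + 2 blocks, namely the
    diamonds and the two pendant vertices.  A spanning tree has at most one leaf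
    in each block: a and d are cut vertices of the graph, hence never leaves, and
    deleting both b and c disconnects the graph, whereas deleting leaves from a
    connected graph leaves it connected ([connected_cut_leaves]).

    At least k + 2 ([leaves_chain_tree]): keep ab, ac and bd in every diamond,
    and all the bridges and pendant edges.  Then every c is a leaf, and so are
    the two pendant vertices. *)

Set Implicit Arguments.
Unset Strict Implicit.
Unset Printing Implicit Defensive.

(** * Cuts and degrees *)

Lemma connected_cut (T : finType) (e : rel T) (S : {pred T}) (x0 y0 : T) :
  connected e -> x0 \in S -> y0 \notin S ->
  exists x y, [/\ x \in S, y \notin S & e x y].
Proof.
move=> /forallP/(_ x0)/forallP/(_ y0)/connectP[p ep ->].
elim: p x0 ep => [|x1 p IHp] x0 /=; first by move=> _ ->.
case/andP=> e01 ep Sx0 Slast; case: (boolP (x1 \in S)) => Sx1; first exact: (IHp x1).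
by exists x0, x1.
Qed.

(** Deleting leaves from a connected graph leaves it connected: a leaf in L
    belongs with its only neighbour, so let the leaves hanging from S be moved to
    the side of S.  No edge from a moved leaf crosses the enlarged cut, and no
    edge from S crosses it to end at a leaf; hence a crossing edge, which exists
    by connectedness, is one of the wanted edges. *)
Lemma connected_cut_leaves (T : finType) (e : rel T) (L S : {pred T}) (x0 y0 : T) :
  symmetric e -> connected e -> x0 \in S -> y0 \notin [predU S & L] ->
  {in L, forall x, degree e x = 1} ->
  exists x y, [/\ x \in S, y \notin [predU S & L] & e x y].
Proof.
move=> e_sym e_conn Sx0 y0_out L_leaf.
pose S' := [pred x | (x \in S) || (x \in L) && [exists y in S, e x y]].
have [||x [y [S'x]]] := @connected_cut _ e S' x0 y0 e_conn.
- by rewrite inE Sx0.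
- by move: y0_out; rewrite !inE !negb_or negb_and => /andP[-> ->].
rewrite inE negb_or => /andP[Sy Ly] exy.
case/orP: S'x => [Sx | /andP[Lx /exists_inP[z Sz exz]]].
  exists x, y; split=> //; rewrite inE negb_or Sy; apply: contra Ly => ->.
  by apply/exists_inP; exists x; rewrite // e_sym.
have /eqP/cards1P[w Ew] := L_leaf x Lx.
have yw : y \in [set w] by rewrite -Ew inE.
have zw : z \in [set w] by rewrite -Ew inE.
by case/negP: Sy; rewrite (set1P yw) -(set1P zw).
Qed.

(** Reduces counting the neighbours of an ordinal to exhibiting a list of
    natural numbers, where linear arithmetic applies. *)
Lemma card_ord_seq n (P : pred nat) (s : seq nat) :
  uniq s -> (forall y, (y \in s) = (y < n) && P y) ->
  #|[set y : 'I_n | P y]| = size s.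
Proof.
move=> s_uniq sP; rewrite cardE -(size_map val); apply: perm_size.
apply: uniq_perm => // [|y]; first by rewrite map_inj_uniq ?enum_uniq //; exact: val_inj.
rewrite sP; apply/mapP/andP => [[z]|[y_lt Py]].
  by rewrite mem_enum inE => Pz ->; split; first exact: ltn_ord.
by exists (Ordinal y_lt); rewrite ?mem_enum ?inE.
Qed.

Lemma edge_rel_sym (T : finType) (F : {set {set T}}) : symmetric (edge_rel F).
Proof. by move=> x y; rewrite /edge_rel /= setUC. Qed.

Lemma edge_relS (G : sgraph) (F : {set {set G}}) (x y : G) :
  F \subset edges G -> edge_rel F x y -> adj x y.
Proof.
move=> /subsetP FE /FE/imsetP[[u v]]; rewrite inE /= => uv E.
have [ux vx] : u \in [set x; y] /\ v \in [set x; y] by rewrite E !inE !eqxx orbT.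
have [xu yu] : x \in [set u; v] /\ y \in [set u; v] by rewrite -E !inE !eqxx orbT.
move: ux vx xu yu uv; rewrite !inE.
case/orP=> /eqP-> /orP[]/eqP->; rewrite ?orbb.
- by rewrite adj_irr.
- by [].
- by rewrite adj_sym.
- by rewrite adj_irr.
Qed.

(** * Trees given by a parent function *)

Section ParentTree.
Variables (T : finType) (p : T -> T) (r : T) (h : T -> nat).
Hypothesis h_parent : forall x, x != r -> h (p x) < h x.

Definition parent_edges : {set {set T}} := [set [set p x; x] | x in [set~ r]].

Lemma parent_edgesE x y :
  edge_rel parent_edges x y = (x != r) && (y == p x) || (y != r) && (x == p y).
Proof.
apply/imsetP/orP => [[z]|].
  rewrite !inE => z_r E.
  have [pz zz] : p z \in [set x; y] /\ z \in [set x; y] by rewrite E !inE !eqxx orbT.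
  have [xz yz] : x \in [set p z; z] /\ y \in [set p z; z] by rewrite -E !inE !eqxx orbT.
  have pzz : p z != z by apply: contraTneq (h_parent z_r) => ->; rewrite ltnn.
  move: pz zz xz yz; rewrite !inE.
  case/orP=> /eqP E1 /orP[] /eqP E2; move: pzz; rewrite E1 -?E2 ?eqxx //.
  - by move=> _ _ _; right; rewrite z_r -E1 eqxx.
  - by move=> _ _ _; left; rewrite z_r -E1 eqxx.
case=> /andP[z_r /eqP->]; [exists x | exists y]; rewrite ?inE //.
by rewrite setUC.
Qed.

Lemma parent_edges_connected : connected (edge_rel parent_edges).
Proof.
have to_root x : connect (edge_rel parent_edges) x r.
  have [n] := ubnP (h x); elim: n x => // n IHn x hx.
  have [-> | x_r] := eqVneq x r; first exact: connect0.
  apply: connect_trans (connect1 _) (IHn (p x) _).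
    by rewrite parent_edgesE x_r eqxx.
  exact: leq_trans (h_parent x_r) hx.
apply/forallP=> x; apply/forallP=> y; apply: connect_trans (to_root x) _.
by rewrite (sym_connect_sym (edge_rel_sym _)) to_root.
Qed.

(** On a cycle, both neighbours of a vertex of maximal height would have to be
    its parent. *)
Lemma parent_edges_acyclic : acyclic (edge_rel parent_edges).
Proof.
apply/acyclicP => c c_gt2 c_cyc.
have c_in : nth r c 0 \in c by rewrite mem_nth // (leq_trans _ c_gt2).
case: (arg_maxnP h c_in) => m m_in m_max.
have nbr y : y \in c -> edge_rel parent_edges m y -> y = p m.
  move=> /m_max hy; rewrite parent_edgesE => /orP[/andP[_ /eqP]//|/andP[/h_parent + /eqP E]].
  by rewrite -E ltnNge -/(is_true _) (hy : h y <= h m).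
have [i s Es] := rot_to m_in.
have mem_c z : (z \in m :: s) = (z \in c) by rewrite -Es mem_rot.
have : ucycle (edge_rel parent_edges) (m :: s) by rewrite -Es rot_ucycle.
have : 2 < size (m :: s) by rewrite -Es size_rot.
case: s {Es} mem_c => [|y s] // mem_c; case/lastP: s mem_c => [|s z] // mem_c _.
rewrite /ucycle /= rcons_path last_rcons.
case/andP=> /and3P[my _ zm] /and3P[_ + _].
rewrite edge_rel_sym in zm.
have -> : y = p m by apply: nbr my; rewrite -mem_c !inE eqxx orbT.
have -> : z = p m by apply: nbr zm; rewrite -mem_c !inE mem_rcons mem_head !orbT.
by rewrite mem_rcons mem_head.
Qed.

End ParentTree.

(** * The chain of diamonds *)

(** The vertices are numbered along a Hamiltonian path: the pendant vertices are
    0 and 4k + 1, and the i-th diamond is a, b, c, d = 4i + 1, .., 4i + 4.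
    Besides the edges of the path there are only the chords ac and bd, which
    start at the residues 1 and 2 modulo 4. *)
Definition link (x y : nat) : bool :=
  (y == x.+1) || (0 < x %% 4 < 3) && (y == x.+2).

Definition chain_adj k : rel 'I_(4 * k).+2 := fun x y => link x y || link y x.

Lemma chain_adj_sym k : symmetric (@chain_adj k).
Proof. by move=> x y; rewrite /chain_adj orbC. Qed.

Lemma chain_adj_irr k : irreflexive (@chain_adj k).
Proof. by move=> x; rewrite /chain_adj /link; lia. Qed.

Definition chain k : sgraph := SGraph (@chain_adj_sym k) (@chain_adj_irr k).

Lemma chain_degree k (x : chain k) :
  degree (@adj (chain k)) x = if 0 < x < (4 * k).+1 then 3 else 1.
Proof.
have x_lt : x < (4 * k).+2 := ltn_ord x.
rewrite /degree (@card_ord_seq _ (fun y => link x y || link y x)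
  (if x == 0 :> nat then [:: 1] else if x == (4 * k).+1 :> nat then [:: 4 * k]
   else if 0 < x %% 4 < 3 then [:: x.-1; x.+1; x.+2] else [:: x.-2; x.-1; x.+1])).
- by do ![case: ifP => //] => *; lia.
- by do ![case: ifP => //] => * /=; rewrite ?inE; lia.
by move=> y; rewrite /link; do ![case: ifP] => *; rewrite !inE; lia.
Qed.

(** * At most k + 2 leaves *)

(** Used with y = x (one leaf) or y = x + 1 (two leaves): the graph without the
    vertices x, .., y is still connected, so some edge jumps over them. *)
Lemma link_over_leaves k (F : {set {set chain k}}) (x y : chain k) :
  F \subset edges (chain k) -> connected (edge_rel F) ->
  degree (edge_rel F) x = 1 -> degree (edge_rel F) y = 1 ->
  x != 0 :> nat -> x <= y <= x.+1 -> y != (4 * k).+1 :> nat ->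
  exists u v, [/\ u < x, y < v & link u v].
Proof.
move=> F_edges F_conn x_leaf y_leaf x_n0 xy y_nmax; have y_lt : y < (4 * k).+2 := ltn_ord y.
have [||z|u [v [ux v_out uv]]] :=
  @connected_cut_leaves _ (edge_rel F) [pred z | z \in [:: x; y]] [pred z : chain k | val z < x]
    ord0 ord_max (edge_rel_sym F) F_conn.
- by rewrite inE lt0n.
- by rewrite !inE -!val_eqE /=; lia.
- by rewrite !inE => /orP[]/eqP->.
exists u, v; move: ux v_out (edge_relS F_edges uv).
by rewrite /= /chain_adj /link !inE -!val_eqE /=; split; lia.
Qed.

(** No edge jumps over a vertex a or d. *)
Lemma leaf_residue k (F : {set {set chain k}}) (x : chain k) :
  F \subset edges (chain k) -> connected (edge_rel F) -> degree (edge_rel F) x = 1 ->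
  [\/ x = 0 :> nat, x = (4 * k).+1 :> nat | 1 < x %% 4].
Proof.
move=> F_edges F_conn x_leaf.
have [?|x_n0] := eqVneq (x : nat) 0; first by constructor 1.
have [?|x_nmax] := eqVneq (x : nat) (4 * k).+1; first by constructor 2.
constructor 3.
have [|u [v []]] := link_over_leaves F_edges F_conn x_leaf x_leaf x_n0 _ x_nmax; first by lia.
by rewrite /link; lia.
Qed.

(** The block of 0 is 0, that of the i-th diamond is i + 1, and that of 4k + 1
    is k + 1. *)
Definition block (x : nat) : nat := (x + 3) %/ 4.

(** Two leaves in one block would be b and c, and no edge jumps over both. *)
Lemma block_leaf_inj k (F : {set {set chain k}}) :
  F \subset edges (chain k) -> connected (edge_rel F) ->
  {in [set x | degree (edge_rel F) x == 1] &, injective (fun x : chain k => block x)}.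
Proof.
move=> F_edges F_conn x y; rewrite !inE.
wlog xy : x y / x <= y.
  by move=> IH hx hy E; case/orP: (leq_total x y) => [/IH|/IH h]; [apply|rewrite h].
move=> /eqP hx /eqP hy; rewrite /block => E; apply/val_inj/eqP => /=.
rewrite eqn_leq xy leqNgt; apply/negP => ltxy.
have x_lt : x < (4 * k).+2 := ltn_ord x; have y_lt : y < (4 * k).+2 := ltn_ord y.
have px := leaf_residue F_edges F_conn hx; have py := leaf_residue F_edges F_conn hy.
have [|||u [v []]] := link_over_leaves F_edges F_conn hx hy.
- by case: px py => ? [] ?; lia.
- by case: px py => ? [] ?; lia.
- by case: px py => ? [] ?; lia.
by rewrite /link; lia.
Qed.

Lemma leaves_le k (F : {set {set chain k}}) : spanning_tree F -> leaves F <= k.+2.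
Proof.
case/and3P => F_edges F_conn _; rewrite /leaves.
have block_lt (x : chain k) : block x < k.+2.
  by have : x < (4 * k).+2 := ltn_ord x; rewrite /block; lia.
rewrite -[leqRHS]card_ord -(@card_in_imset _ _ (fun x => Ordinal (block_lt x))) ?max_card //.
by move=> x y hx hy [] /(block_leaf_inj F_edges F_conn hx hy).
Qed.

(** * A spanning tree with k + 2 leaves *)

(** Rooted at 0, with edges ab, ac, bd and the path edges between the blocks:
    a and b hang from the preceding vertex, c and d from the one before it. *)
Definition chain_parent k (x : chain k) : chain k :=
  inord (if 0 < x %% 4 < 3 then x.-1 else x.-2) : 'I_(4 * k).+2.

Definition chain_tree k : {set {set chain k}} :=
  parent_edges (@chain_parent k) (ord0 : 'I_(4 * k).+2).

Lemma val_chain_parent k (x : chain k) :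
  chain_parent x = (if 0 < x %% 4 < 3 then x.-1 else x.-2) :> nat.
Proof. by have x_lt : x < (4 * k).+2 := ltn_ord x; rewrite inordK; case: ifP => //; lia. Qed.

Lemma chain_parent_lt k (x : chain k) :
  x != (ord0 : 'I_(4 * k).+2) -> chain_parent x < x.
Proof. by rewrite -val_eqE val_chain_parent /=; case: ifP; lia. Qed.

Lemma chain_treeP k : spanning_tree (chain_tree k).
Proof.
apply/and3P; split.
- apply/subsetP=> _ /imsetP[x x_n0 ->]; apply/imsetP; exists (chain_parent x, x) => //.
  move: x_n0; rewrite !inE -val_eqE /= /chain_adj /link val_chain_parent; case: ifP; lia.
- exact: (parent_edges_connected (h := val) (@chain_parent_lt k)).
- exact: (parent_edges_acyclic (h := val) (@chain_parent_lt k)).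
Qed.

Lemma leaves_chain_tree k : k.+2 <= leaves (chain_tree k).
Proof.
(* For 0 < j < k + 1 this is the vertex c of a diamond; truncated subtraction
   and the minimum yield the pendant vertices 0 and 4k + 1 at the two ends. *)
have leaf_lt (j : 'I_k.+2) : minn (4 * j).-1 (4 * k).+1 < (4 * k).+2 by lia.
pose leaf j : chain k := Ordinal (leaf_lt j).
have leaf_inj : injective leaf.
  move=> i j [] E; apply/val_inj => /=.
  by have := ltn_ord i; have := ltn_ord j; lia.
rewrite /leaves -[leqLHS]card_ord -(card_imset _ leaf_inj); apply: subset_leq_card.
apply/subsetP => _ /imsetP[j _ ->]; rewrite inE /degree.
have j_lt := ltn_ord j.
(* The only neighbour of the j-th leaf. *)
pose q := if j == 0 :> nat then 1 else if j == k.+1 :> nat then 4 * k else 4 * j - 3.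
have q_lt : q < (4 * k).+2 by rewrite /q; do ![case: ifP => //]; lia.
apply/cards1P; exists (Ordinal q_lt); apply/setP => y.
have y_lt : y < (4 * k).+2 := ltn_ord y.
rewrite !inE (parent_edgesE (h := val) (@chain_parent_lt k)) -!val_eqE /= !val_chain_parent /= /q.
by do ![case: ifP => //]; lia.
Qed.

Lemma max_leaves_chain k : max_leaves (chain k) = k.+2.
Proof.
apply/eqP; rewrite eqn_leq; apply/andP; split.
  by apply/bigmax_leqP => F; exact: leaves_le.
exact: leq_trans (leaves_chain_tree k) (leq_bigmax_cond _ (chain_treeP k)).
Qed.

Lemma nb_vertices_chain k : nb_vertices (chain k) = (4 * k).+2.
Proof. exact: card_ord. Qed.

Lemma nb_deg13_chain k : nb_deg13 (chain k) = (4 * k).+2.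
Proof.
rewrite -nb_vertices_chain /nb_deg13 /nb_vertices -cardsT; congr #|pred_of_set _|.
by apply/setP => x; rewrite !inE chain_degree; case: ifP.
Qed.

Lemma nb_deg_ge4_chain k : nb_deg_ge4 (chain k) = 0.
Proof.
by apply/eqP; rewrite cards_eq0; apply/eqP/setP => x; rewrite !inE chain_degree; case: ifP.
Qed.

(** * The extremal family *)

Local Open Scope ring_scope.

Theorem mainTheorem2 :
  exists G : nat -> sgraph,
    (forall i j : nat, i <> j -> ~ isomorphic (G i) (G j)) /\
    (forall i : nat,
      [/\ connected (@adj (G i)),
          (1 < nb_vertices (G i))%N,
          (forall x : G i, degree (@adj (G i)) x \in [:: 1; 3; 4]%N)
        & (max_leaves (G i))%:R
          = 1 / 3 * (nb_deg_ge4 (G i))%:R + 1 / 4 * (nb_deg13 (G i))%:R + 3 / 2 :> rat]).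
Proof.
exists chain; split=> [i j ij [f /bij_eq_card + _] | k].
  by rewrite -!/(nb_vertices _) !nb_vertices_chain; lia.
have conn : connected (@adj (chain k)).
  have /and3P[F_edges /forallP F_conn _] := chain_treeP k.
  apply/forallP => x; apply/forallP => y; have /forallP/(_ y) := F_conn x.
  by apply: connect_sub => u v /(edge_relS F_edges)/connect1.
split=> //; first by rewrite nb_vertices_chain.
  by move=> x; rewrite chain_degree; case: ifP.
rewrite max_leaves_chain nb_deg_ge4_chain nb_deg13_chain.
by rewrite -(addn2 k) -(addn2 (4 * k)) (natrD _ k) (natrD _ (4 * k)) natrM; lra.
Qed.
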